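(* Let $\mathbf A_b$ be a finitely generated totally ordered pointed Abelian $\ell$-group with $b\neq 0$, and let $\mathbf B_b$ be its convex strongly pointed $\ell$-subgroup. Then $\mathbf{ISP_U}(\mathbf A_b)=\mathbf{ISP_U}(\mathbf B_b)$.
   Context: A pointed Abelian $\ell$-group $\mathbf A_b$ is an Abelian $\ell$-group $\mathbf A$ expanded by a constant $\mathtt f$ interpreted as $b\in A$. A pointed Abelian $\ell$-group $\mathbf B_b$ is strongly pointed if $b$ is a strong unit of $\mathbf B$, i.e. for every $c\in B$ there is $z\in\mathbb Z$ with $z\cdot b\ge c$. The convex strongly pointed $\ell$-subgroup of $\mathbf A_b$ is a convex $\ell$-subgroup $B$ of $A$ containing $b$ such that $\mathbf B_b$ is strongly pointed (it is the smallest convex $\ell$-subgroup containing $b$). $\mathbf{ISP_U}(\mathcal K)$ is the class of algebras isomorphic to subalgebras of ultrapowers of members of $\mathcal K$. *)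

(* Defs.v *)
From HB Require Import structures.
From mathcomp Require Import all_boot all_order all_algebra.
From mathcomp Require Import generic_quotient.
From mathcomp Require Import boolp classical_sets functions filter.

Set Implicit Arguments.
Unset Strict Implicit.
Unset Printing Implicit Defensive.

Import Order.TTheory GRing.Theory Num.Theory.

Local Open Scope classical_set_scope.
Local Open Scope ring_scope.
Local Open Scope quotient_scope.

(* [porderZmodType] is a zmodType with a partial order, without any
   compatibility axiom. The lattice operations are not taken from
   [Order.Lattice] because Hierarchy Builder cannot insert a join of
   [Order.Lattice] and [GRing.Zmodule] below the existing [Num.RealDomain]. *)
HB.mixin Record isLatticeOrdered T of Num.POrderedZmodule T := {
  lgmeet : T -> T -> T;
  lgjoin : T -> T -> T;
  lgmeetP : forall x y z : T, (x <= lgmeet y z) = (x <= y) && (x <= z);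
  lgjoinP : forall x y z : T, (lgjoin x y <= z) = (x <= z) && (y <= z);
  lgroup_leD2l : forall z x y : T, x <= y -> z + x <= z + y
}.

#[short(type="lgroupType")]
HB.structure Definition LGroup :=
  { T of Num.POrderedZmodule T & isLatticeOrdered T }.

HB.mixin Record hasPoint T of LGroup T := { lgpoint : T }.

#[short(type="plgroupType")]
HB.structure Definition PointedLGroup := { T of LGroup T & hasPoint T }.

Notation "x `&` y" := (lgmeet x y) : ring_scope.
Notation "x `|` y" := (lgjoin x y) : ring_scope.
Notation "''f_' A" := (@lgpoint A) (at level 8, A at level 2, format "''f_' A").

Definition strongly_pointed (A : plgroupType) : Prop :=
  forall c : A, exists z : int, c <= 'f_A *~ z.

Definition order_convex (A : plgroupType) (S : set A) : Prop :=
  forall x y z : A, S x -> S z -> x <= y -> y <= z -> S y.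

Record is_plghom (A B : plgroupType) (h : A -> B) : Prop := IsPlghom {
  plghom0 : h 0 = 0;
  plghomN : {morph h : x / - x};
  plghomD : {morph h : x y / x + y};
  plghomI : {morph h : x y / x `&` y};
  plghomU : {morph h : x y / x `|` y};
  plghom_point : h 'f_A = 'f_B
}.

Definition plg_isomorphic (A B : plgroupType) : Prop :=
  exists2 h : A -> B, is_plghom h & bijective h.

Record is_subalgebra (A : plgroupType) (S : set A) : Prop := IsSubalgebra {
  subalg0 : S 0;
  subalgN : forall x, S x -> S (- x);
  subalgD : forall x y, S x -> S y -> S (x + y);
  subalgI : forall x y, S x -> S y -> S (x `&` y);
  subalgU : forall x y, S x -> S y -> S (x `|` y);
  subalg_point : S 'f_A
}.

Definition finitely_generated (A : plgroupType) : Prop :=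
  exists s : seq A, smallest (@is_subalgebra A) [set` s] = setT.

Record subalgebra (A : plgroupType) := Subalgebra {
  subalg_set :> set A;
  subalgP : is_subalgebra subalg_set
}.

Section SubalgebraStructure.
Variables (A : plgroupType) (S : subalgebra A).

Definition subalg_type : Type := {x : A | x \in subalg_set S}.

HB.instance Definition _ := SubChoice.on subalg_type.

Fact subalg_zmod_closed : zmod_closed (mem (subalg_set S)).
Proof.
have SP := subalgP S; split=> [|x y]; rewrite !in_setE; first exact: subalg0 SP.
by move=> Sx Sy; apply: (subalgD SP Sx); apply: (subalgN SP).
Qed.

HB.instance Definition _ :=
  GRing.SubChoice_isSubZmodule.Build A _ subalg_type subalg_zmod_closed.

HB.instance Definition _ :=
  Order.SubChoice_isSubPOrder.Build ring_display A _ ring_display subalg_type.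

Fact subalg_meet_in (x y : subalg_type) : val x `&` val y \in subalg_set S.
Proof.
by rewrite in_setE; apply: (subalgI (subalgP S)); rewrite -in_setE; apply: valP.
Qed.

Fact subalg_join_in (x y : subalg_type) : val x `|` val y \in subalg_set S.
Proof.
by rewrite in_setE; apply: (subalgU (subalgP S)); rewrite -in_setE; apply: valP.
Qed.

Definition subalg_meet (x y : subalg_type) : subalg_type :=
  exist _ (val x `&` val y) (subalg_meet_in x y).

Definition subalg_join (x y : subalg_type) : subalg_type :=
  exist _ (val x `|` val y) (subalg_join_in x y).

Fact subalg_meetP (x y z : subalg_type) :
  (x <= subalg_meet y z) = (x <= y) && (x <= z).
Proof. by rewrite -!Order.le_val /= lgmeetP. Qed.

Fact subalg_joinP (x y z : subalg_type) :
  (subalg_join x y <= z) = (x <= z) && (y <= z).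
Proof. by rewrite -!Order.le_val /= lgjoinP. Qed.

Fact subalg_leD2l (z x y : subalg_type) : x <= y -> z + x <= z + y.
Proof. by rewrite -!Order.le_val; apply: lgroup_leD2l. Qed.

HB.instance Definition _ := isLatticeOrdered.Build subalg_type
  subalg_meetP subalg_joinP subalg_leD2l.

Fact subalg_point_in : 'f_A \in subalg_set S.
Proof. by rewrite in_setE; apply: subalg_point (subalgP S). Qed.

HB.instance Definition _ :=
  hasPoint.Build subalg_type (exist _ 'f_A subalg_point_in).

Definition subalg_plgroup : plgroupType := subalg_type.

Lemma val_subalg_plghom : is_plghom (val : subalg_plgroup -> A).
Proof. by []. Qed.

End SubalgebraStructure.

Coercion subalg_plgroup : subalgebra >-> PointedLGroup.type.

Section Ultrapower.
Variables (A : plgroupType) (I : Type) (F : set_system I).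
Hypothesis FU : UltraFilter F.

Definition up_eq (u v : I -> A) : bool := `[< \forall i \near F, u i = v i >].

Fact up_eq_refl : reflexive up_eq.
Proof. by move=> u; apply/asboolP; apply: nearW. Qed.

Fact up_eq_sym : symmetric up_eq.
Proof. by move=> u v; apply/asboolP/asboolP; apply: filterS => i ->. Qed.

Fact up_eq_trans : transitive up_eq.
Proof.
move=> v u w /asboolP uv /asboolP vw; apply/asboolP.
by apply: filterS2 uv vw => i -> ->.
Qed.

Canonical up_equiv := EquivRel up_eq up_eq_refl up_eq_sym up_eq_trans.

Definition up_type : Type := {eq_quot up_equiv}.

HB.instance Definition _ := Choice.on up_type.
HB.instance Definition _ := EqQuotient.on up_type.

Definition up_class (u : I -> A) : up_type := \pi u.

Lemma up_classP (u v : I -> A) :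
  up_class u = up_class v <-> \forall i \near F, u i = v i.
Proof.
split=> [/eqmodP /asboolP //|uv]; apply/eqmodP; exact/asboolP.
Qed.

Lemma up_class_surj (x : up_type) : exists u, x = up_class u.
Proof. by exists (repr x); rewrite /up_class reprK. Qed.

Lemma up_class_repr (u : I -> A) : \forall i \near F, repr (up_class u) i = u i.
Proof. by apply/up_classP; rewrite /up_class reprK. Qed.

Definition up_zero : up_type := up_class (fun=> 0).
Definition up_opp (x : up_type) : up_type := up_class (fun i => - repr x i).
Definition up_add (x y : up_type) : up_type :=
  up_class (fun i => repr x i + repr y i).
Definition up_meet (x y : up_type) : up_type :=
  up_class (fun i => repr x i `&` repr y i).
Definition up_join (x y : up_type) : up_type :=
  up_class (fun i => repr x i `|` repr y i).
Definition up_le (x y : up_type) : bool :=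
  `[< \forall i \near F, repr x i <= repr y i >].

Fact up_oppE u : up_opp (up_class u) = up_class (fun i => - u i).
Proof. by apply/up_classP; apply: filterS (up_class_repr u) => i ->. Qed.

Fact up_op2E (op : A -> A -> A) u v :
  up_class (fun i => op (repr (up_class u) i) (repr (up_class v) i)) =
  up_class (fun i => op (u i) (v i)).
Proof.
apply/up_classP.
by apply: filterS2 (up_class_repr u) (up_class_repr v) => i -> ->.
Qed.

Fact up_addE u v :
  up_add (up_class u) (up_class v) = up_class (fun i => u i + v i).
Proof. exact: up_op2E. Qed.

Fact up_meetE u v :
  up_meet (up_class u) (up_class v) = up_class (fun i => u i `&` v i).
Proof. exact: up_op2E. Qed.

Fact up_joinE u v :
  up_join (up_class u) (up_class v) = up_class (fun i => u i `|` v i).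
Proof. exact: up_op2E. Qed.

Fact up_leE u v :
  up_le (up_class u) (up_class v) = `[< \forall i \near F, u i <= v i >].
Proof.
have ru := up_class_repr u; have rv := up_class_repr v.
by apply/asboolP/asboolP; apply: filterS3 ru rv => i -> ->.
Qed.

Fact up_addA : associative up_add.
Proof.
move=> x y z; have [u ->] := up_class_surj x; have [v ->] := up_class_surj y.
have [w ->] := up_class_surj z; rewrite !up_addE.
by apply/up_classP; apply: nearW => i; rewrite addrA.
Qed.

Fact up_addC : commutative up_add.
Proof. by move=> x y; apply/up_classP; apply: nearW => i; rewrite addrC. Qed.

Fact up_add0 : left_id up_zero up_add.
Proof.
move=> x; have [u ->] := up_class_surj x; rewrite up_addE.
by apply/up_classP; apply: nearW => i; rewrite add0r.
Qed.

Fact up_addN : left_inverse up_zero up_opp up_add.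
Proof.
move=> x; have [u ->] := up_class_surj x; rewrite up_oppE up_addE.
by apply/up_classP; apply: nearW => i; rewrite addNr.
Qed.

HB.instance Definition _ :=
  GRing.isZmodule.Build up_type up_addA up_addC up_add0 up_addN.

Fact up_le_refl : reflexive up_le.
Proof. by move=> x; apply/asboolP; apply: nearW. Qed.

Fact up_le_anti : antisymmetric up_le.
Proof.
move=> x y /andP[]; have [u ->] := up_class_surj x.
have [v ->] := up_class_surj y; rewrite !up_leE => /asboolP uv /asboolP vu.
by apply/up_classP; apply: filterS2 uv vu => i ? ?; apply: le_anti; apply/andP.
Qed.

Fact up_le_trans : transitive up_le.
Proof.
move=> y x z /asboolP xy /asboolP yz; apply/asboolP.
by apply: filterS2 xy yz => i; apply: le_trans.
Qed.

HB.instance Definition _ := Order.Le_isPOrder.Build ring_display up_type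
  up_le_refl up_le_anti up_le_trans.

Fact up_meetP (x y z : up_type) : (x <= up_meet y z) = (x <= y) && (x <= z).
Proof.
have [u ->] := up_class_surj x; have [v ->] := up_class_surj y.
have [w ->] := up_class_surj z; rewrite /Order.le /= up_meetE !up_leE.
rewrite -asbool_and; apply/asboolP/asboolP => [uvw|[uv uw]].
  by split; apply: filterS uvw => i; rewrite lgmeetP => /andP[].
by apply: filterS2 uv uw => i uv uw; rewrite lgmeetP uv.
Qed.

Fact up_joinP (x y z : up_type) : (up_join x y <= z) = (x <= z) && (y <= z).
Proof.
have [u ->] := up_class_surj x; have [v ->] := up_class_surj y.
have [w ->] := up_class_surj z; rewrite /Order.le /= up_joinE !up_leE.
rewrite -asbool_and; apply/asboolP/asboolP => [uvw|[uw vw]].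
  by split; apply: filterS uvw => i; rewrite lgjoinP => /andP[].
by apply: filterS2 uw vw => i uw vw; rewrite lgjoinP uw.
Qed.

Fact up_leD2l (z x y : up_type) : x <= y -> z + x <= z + y.
Proof.
have [u ->] := up_class_surj x; have [v ->] := up_class_surj y.
have [w ->] := up_class_surj z.
rewrite /Order.le /GRing.add /= !up_addE !up_leE => /asboolP uv.
by apply/asboolP; apply: filterS uv => i; apply: lgroup_leD2l.
Qed.

HB.instance Definition _ :=
  isLatticeOrdered.Build up_type up_meetP up_joinP up_leD2l.

HB.instance Definition _ := hasPoint.Build up_type (up_class (fun=> 'f_A)).

Definition ultrapower : plgroupType := up_type.

End Ultrapower.

Definition plg_class := plgroupType -> Prop.

Inductive class_sing (A : plgroupType) : plg_class :=
  ClassSing : class_sing A A.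

Inductive class_I (K : plg_class) : plg_class :=
  ClassI (A B : plgroupType) : K A -> plg_isomorphic B A -> class_I K B.

Inductive class_S (K : plg_class) : plg_class :=
  ClassS (A : plgroupType) (S : subalgebra A) : K A -> class_S K S.

(* Ultrapowers of single members of [K], not arbitrary ultraproducts; the two
   agree on a one-element class. *)
Inductive class_PU (K : plg_class) : plg_class :=
  ClassPU (A : plgroupType) (I : Type) (F : set_system I) (FU : UltraFilter F) :
    K A -> class_PU K (ultrapower A FU).

Definition class_ISPU (K : plg_class) : plg_class :=
  class_I (class_S (class_PU K)).

(* Main.v *)
(** Every finite subset X of A embeds partially into B.  Collect the positive
    elements of X and -X outside B into a tuple Y.  It suffices to choose
    arbitrarily large z_i in B satisfying the same relations modulo B as the
    Y_i: then sum c_i Y_i + u |-> sum c_i z_i + u is additive, is the identity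
    on B, and is positive on the positive elements of X.  If the Y_i are
    independent modulo B, any large z_i will do; otherwise a Euclidean descent
    on a relation, in the style of Elliott's theorem that totally ordered
    groups are ultrasimplicial, repeatedly subtracts a generator from a larger
    one until two of them agree modulo B and one can be dropped.  Gluing the
    partial embeddings along the filter of finite subsets embeds each
    ultrapower of A into an ultrapower of B. *)

Require Import Defs.
From mathcomp Require Import all_boot all_order all_algebra.
From mathcomp Require Import boolp classical_sets functions filter.
From mathcomp Require Import zify.

Set Implicit Arguments.
Unset Strict Implicit.
Unset Printing Implicit Defensive.

Import Order.TTheory GRing.Theory Num.Theory.

Local Open Scope ring_scope.

(** * Order arithmetic in Abelian lattice-ordered groups *)

Section LatticeOrderedGroup.
Context {A : lgroupType}.
Implicit Types x y z : A.

Lemma lg_subr_ge0 x y : (0 <= y - x) = (x <= y).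
Proof.
apply/idP/idP => [/(lgroup_leD2l x)|/(lgroup_leD2l (- x))].
  by rewrite addr0 addrC subrK.
by rewrite addNr addrC.
Qed.

Lemma lg_addr_ge0 x y : 0 <= x -> 0 <= y -> 0 <= x + y.
Proof. by move=> x0 /(lgroup_leD2l x); rewrite addr0; apply: le_trans x0. Qed.

Lemma lg_le_addr x y : 0 <= y -> x <= x + y.
Proof. by move=> y0; rewrite -lg_subr_ge0 addrC addKr. Qed.

Lemma lg_oppr_ge0 x : (0 <= - x) = (x <= 0).
Proof. by rewrite -lg_subr_ge0 sub0r. Qed.

Lemma lg_mulrz_ge0 x (n : int) : 0 <= x -> 0 <= n -> 0 <= x *~ n.
Proof.
case: n => // n x0 _; elim: n => [|n IH]; first by rewrite mulr0z.
by rewrite -addn1 PoszD mulrzDr lg_addr_ge0.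
Qed.

Lemma lg_sumr_ge0 (I : finType) (P : pred I) (F : I -> A) :
  (forall i, 0 <= F i) -> 0 <= \sum_(i | P i) F i.
Proof.
by move=> F0; apply: (big_ind (fun x => 0 <= x)) => // x y; apply: lg_addr_ge0.
Qed.

Lemma lgmeet_l x y : x <= y -> x `&` y = x.
Proof.
move=> xy; apply/le_anti; rewrite lgmeetP lexx xy !andbT.
by have: x `&` y <= x `&` y := lexx _; rewrite lgmeetP => /andP[].
Qed.

Lemma lgmeet_r x y : y <= x -> x `&` y = y.
Proof.
move=> yx; apply/le_anti; rewrite lgmeetP lexx yx !andbT.
by have: x `&` y <= x `&` y := lexx _; rewrite lgmeetP => /andP[].
Qed.

Lemma lgjoin_l x y : y <= x -> x `|` y = x.
Proof.
move=> yx; apply/le_anti; rewrite lgjoinP lexx yx /=.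
by have: x `|` y <= x `|` y := lexx _; rewrite lgjoinP => /andP[].
Qed.

Lemma lgjoin_r x y : x <= y -> x `|` y = y.
Proof.
move=> xy; apply/le_anti; rewrite lgjoinP lexx xy /=.
by have: x `|` y <= x `|` y := lexx _; rewrite lgjoinP => /andP[].
Qed.

End LatticeOrderedGroup.

(** * Integer combinations and elementary shears *)

Definition zcomb {A : zmodType} {m} (Y : 'I_m -> A) (c : 'I_m -> int) : A :=
  \sum_i Y i *~ c i.

Definition shear {V : zmodType} {m} (i j : 'I_m) (Y : 'I_m -> V) : 'I_m -> V :=
  fun k => Y k + (if k == i then Y j else 0).

Section IntegerCombinations.
Context {A : zmodType}.

Lemma zcombN m (Y : 'I_m -> A) c : zcomb Y (fun k => - c k) = - zcomb Y c.
Proof. by rewrite /zcomb -sumrN; apply: eq_bigr => k _; rewrite mulrNz. Qed.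

Lemma zcombB m (Y : 'I_m -> A) c d :
  zcomb Y (fun k => c k - d k) = zcomb Y c - zcomb Y d.
Proof. by rewrite /zcomb -sumrB; apply: eq_bigr => k _; rewrite mulrzBr. Qed.

Lemma zcomb_single m (Y : 'I_m -> A) i (n : int) :
  zcomb Y (fun k => if k == i then n else 0) = Y i *~ n.
Proof.
rewrite /zcomb (bigD1 i) //= eqxx big1 ?addr0 // => k /negbTE ->.
by rewrite mulr0z.
Qed.

(** A shear is an elementary matrix; moving it from generators to coefficients transposes it, which
    swaps [i] and [j]. *)
Lemma zcomb_shear m i j (Y : 'I_m -> A) c :
  zcomb (shear i j Y) c = zcomb Y (shear j i c).
Proof.
have sE k : shear i j Y k *~ c k =
    Y k *~ c k + (if k == i then Y j *~ c i else 0).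
  by rewrite /shear mulrzDl; case: eqP => [->|]; rewrite ?mul0rz.
rewrite /zcomb (eq_bigr _ (fun k _ => sE k)) big_split -big_mkcond big_pred1_eq.
under [RHS]eq_bigr => k _ do rewrite /shear mulrzDr.
rewrite big_split; congr (_ + _); rewrite (bigD1 j) //= eqxx big1 ?addr0 //.
by move=> k /negbTE ->; rewrite mulr0z.
Qed.

Lemma zcomb_lift m (i : 'I_m.+1) (Y : 'I_m.+1 -> A) c :
  zcomb Y c =
    Y i *~ c i + zcomb (fun k => Y (lift i k)) (fun k => c (lift i k)).
Proof. by rewrite /zcomb (bigD1_ord i). Qed.

End IntegerCombinations.

(** * Lifting elements above a convex subgroup into that subgroup *)

Section Lifting.
Context {A : plgroupType} (B : set A) (BP : is_subalgebra B).
Hypotheses (A_total : total (<=%R : rel A)) (B_convex : order_convex B).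

Lemma subalgB x y : B x -> B y -> B (x - y).
Proof.
move=> Bx By.
by apply: (subalgD BP) => //; apply: (subalgN BP).
Qed.

Lemma subalgMz x (n : int) : B x -> B (x *~ n).
Proof.
move=> Bx;
have Bn (k : nat) : B (x *+ k).
  elim: k => [|k IH]; first by rewrite mulr0n; apply: subalg0 BP.
  by rewrite mulrS; apply: subalgD BP _ _ Bx IH.
by case: n => k; [exact: Bn | exact: subalgN BP _ (Bn _)].
Qed.

(** By convexity and totality, such an [x] exceeds every element of [B]. *)
Definition above x : Prop := 0 < x /\ ~ B x.

Lemma above_cases x : [\/ B x, above x | above (- x)].
Proof.
have [Bx|nBx] := pselect (B x); first by constructor 1.
have x0 : x != 0 by apply: contra_notN nBx => /eqP ->; apply: subalg0 BP.
have [x_ge0|x_le0] := orP (A_total 0 x).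
  by constructor 2; split; rewrite // lt_def x0.
constructor 3; split; first by rewrite lt_def oppr_eq0 x0 lg_oppr_ge0.
by move=> /(subalgN BP); rewrite opprK.
Qed.

(* [w] is arbitrary so that a generator congruent to another one modulo [B]
   can be dropped: its lift is the other lift plus a fixed element of [B]. *)
Definition liftable {m} (Y : 'I_m -> A) : Prop :=
  forall w, B w -> exists2 z : 'I_m -> A,
    (forall i, B (z i) /\ w <= z i) &
    (forall c, B (zcomb Y c) -> zcomb z c = zcomb Y c).

(** Lifts of [Y] above both [w] and 0 stay above [w] when one is added to another. *)
Lemma liftable_shear m (i j : 'I_m) (Y : 'I_m -> A) :
  liftable Y -> liftable (shear i j Y).
Proof.
move=> liftY w Bw.
have [z zP zE] := liftY _ (subalgU BP Bw (subalg0 BP)).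
have z_ge k : w <= z k /\ 0 <= z k.
  by have [_] := zP k; rewrite lgjoinP => /andP.
exists (shear i j z) => [k|c]; last by rewrite !zcomb_shear; apply: zE.
have [[Bk _] [Bj _]] := (zP k, zP j); have [wk _] := z_ge k.
rewrite /shear; case: ifP => _; last by rewrite addr0.
split; first exact: subalgD.
by apply: le_trans wk _; apply: lg_le_addr; have [] := z_ge j.
Qed.

Lemma liftable_congr m (i : 'I_m.+1) (j : 'I_m) (Y : 'I_m.+1 -> A) :
  B (Y i - Y (lift i j)) -> liftable (fun k => Y (lift i k)) -> liftable Y.
Proof.
set d := Y i - _ => Bd liftY w Bw.
(* The bound [w - d] keeps [z j + d], the lift of the dropped generator, above [w]. *)
have [z zP zE] := liftY _ (subalgU BP Bw (subalgB Bw Bd)).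
have z_ge k : w <= z k /\ w - d <= z k.
  by have [_] := zP k; rewrite lgjoinP => /andP.
pose z' k := if unlift i k is Some k' then z k' else z j + d.
have z'i : z' i = z j + d by rewrite /z' unlift_none.
have z'l k : z' (lift i k) = z k by rewrite /z' liftK.
exists z' => [k|c].
  have [[Bzj _] [_ zj]] := (zP j, z_ge j).
  case: (unliftP i k) => [k' ->|->].
    by rewrite z'l; have [? _] := zP k'; have [? _] := z_ge k'.
  rewrite z'i; split; first exact: subalgD.
  by move: zj => /(lgroup_leD2l d); rewrite addrC subrK addrC.
(* Applied to both [Y] and [z']: the coefficient of the dropped generator moves to generator [j], at
   the cost of [d *~ c i], which lies in [B]. *)
have splitE (u : 'I_m.+1 -> A) : u i = u (lift i j) + d ->
    zcomb u c = d *~ c i + zcomb (fun k => u (lift i k))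
      (fun k => c (lift i k) + (if k == j then c i else 0)).
  move=> ui; rewrite (zcomb_lift i) ui mulrzDl [u _ *~ _ + _]addrC -addrA.
  congr (_ + _); rewrite addrC /zcomb.
  under [RHS]eq_bigr => k _ do rewrite mulrzDr.
  rewrite big_split; congr (_ + _).
  by rewrite -(zcomb_single (fun k => u (lift i k))).
have Yi : Y i = Y (lift i j) + d by rewrite /d addrC subrK.
rewrite (splitE Y Yi) splitE ?z'i ?z'l // => BY.
have -> : zcomb (fun k => z' (lift i k)) = zcomb z.
  by congr zcomb; apply: funext => k.
rewrite zE //; have := subalgB BY (subalgMz (c i) Bd).
by rewrite addrC addKr.
Qed.

(** Otherwise [0 <= Y i <= zcomb Y c], and convexity would put [Y i] in [B]. *)
Lemma zcomb_above_neg m (Y : 'I_m -> A) (c : 'I_m -> int) i :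
  (forall k, above (Y k)) -> B (zcomb Y c) -> 0 < c i -> exists j, c j < 0.
Proof.
move=> Y_above BYc ci; apply: contrapT => /forallNP c_ge0.
have {}c_ge0 k : 0 <= c k by rewrite leNgt; apply/negP/c_ge0.
have Y_ge0 k : 0 <= Y k by have [/ltW] := Y_above k.
have [_] := Y_above i; apply; apply: B_convex (subalg0 BP) BYc _ _ => //.
have -> : zcomb Y c = Y i + (Y i *~ (c i - 1) + \sum_(k | k != i) Y k *~ c k).
  by rewrite /zcomb (bigD1 i) //= addrA -[X in X + Y i *~ _]mulr1z -mulrzDr
     [1 + _]addrC subrK.
apply: lg_le_addr; apply: lg_addr_ge0.
  by apply: lg_mulrz_ge0; rewrite ?subr_ge0.
by apply: lg_sumr_ge0 => k; apply: lg_mulrz_ge0.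
Qed.

(* Euclidean descent on a nontrivial relation [c].  The coefficients stay in
   [- a, b] with [a <= b]; pairing a coefficient equal to [b] with a negative
   one and subtracting the smaller generator from the larger replaces one of
   the two coefficients by their sum, which lies in [0, b). *)
Lemma liftable_descent m :
    (forall Y : 'I_m -> A, (forall k, above (Y k)) -> liftable Y) ->
  forall (n a b k : nat) (Y : 'I_m.+1 -> A) (c : 'I_m.+1 -> int),
    (a + b <= n)%N -> (a <= b)%N -> (forall k, above (Y k)) ->
    B (zcomb Y c) -> (exists i, c i != 0) ->
    (forall i, - a%:Z <= c i <= b%:Z) ->
    (#|[pred i | (c i < 0) || (c i == b%:Z)]%R| <= k)%N ->
  liftable Y.
Proof.
move=> IHm; elim=> [|n IHn] a b k.
  move=> Y c ab _ _ _ [i ci] /(_ i) cb _; exfalso; lia.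
(* If no coefficient equals [b], the upper bound drops to [b - 1]. When this falls below [a],
   negating the relation swaps the two bounds. Either way their sum decreases. *)
have lower_b (Y : 'I_m.+1 -> A) (c : 'I_m.+1 -> int) :
    (a + b <= n.+1)%N -> (a <= b)%N -> (0 < b)%N ->
    (forall k, above (Y k)) -> B (zcomb Y c) -> (exists i, c i != 0) ->
    (forall i, - a%:Z <= c i <= b%:Z) -> ~ (exists i, c i == b%:Z) ->
    liftable Y.
  move=> abn ab b_gt0 Y_above BYc [i0 ci0] cb /forallNP no_b.
  have {}cb i : - a%:Z <= c i <= b.-1%:Z by have := cb i; have := no_b i; lia.
  have [ab'|ba] := leqP a b.-1.
      apply: (IHn a b.-1 m.+1 Y c) => //; [lia | by exists i0 |].
    by rewrite -[X in (_ <= X)%N]card_ord max_card.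
  apply: (IHn b.-1 a m.+1 Y (fun i => - c i)) => //; try lia.
  - by rewrite zcombN; apply: subalgN BP _ BYc.
  - by exists i0; rewrite oppr_eq0.
  - by move=> i; have := cb i; lia.
  - by rewrite -[X in (_ <= X)%N]card_ord max_card.
(* Inner induction on the number of coefficients that are negative or equal to [b]. *)
elim: k => [|k IHk] Y c abn ab Y_above BYc [i0 ci0] cb cardP.
all: have b_gt0 : (0 < b)%N by have := cb i0; lia.
all: have [[i /eqP ci]|no_b] := pselect (exists i, c i == b%:Z);
  last by apply: (lower_b Y c) => //; exists i0.
  have /card0_eq/(_ i) :
    #|[pred i | (c i < 0) || (c i == b%:Z)]%R| = 0%N by lia.
  by rewrite inE ci eqxx orbT.
have [j cj] : exists j, c j < 0 by apply: (zcomb_above_neg (i := i)) => //; lia.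
(* Writing [Y q] as [(Y q - Y p) + Y p] turns the coefficient of [Y p] into [c p + c q]. This
   removes [p] from the counted indices and adds none; the unchanged [c q] keeps the relation
   nontrivial. *)
have step p q : p != q -> 0 <= c p + c q < b%:Z -> (c p < 0) || (c p == b%:Z) ->
    c q != 0 -> above (Y q - Y p) -> liftable Y.
  move=> pq cpq Pp cq Yqp; pose Y' k := Y k - (if k == q then Y p else 0).
  have YE : Y = shear q p Y'.
    apply: funext => l; rewrite /shear /Y' (negbTE pq) subr0.
    by case: eqP; rewrite ?subrK ?addr0 ?subr0.
  rewrite YE; apply: liftable_shear; apply: (IHk _ (shear p q c)) => //.
  - by move=> l; rewrite /Y'; case: eqP => [->//|_]; rewrite subr0.
  - by rewrite -zcomb_shear -YE.
  - by exists q; rewrite /shear [q == p]eq_sym (negbTE pq) addr0.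
  - move=> l; rewrite /shear; have := cb l; case: eqP => [->|_]; lia.
  - rewrite -ltnS; apply: leq_trans cardP; apply: proper_card; apply/properP.
    split; last first.
      by exists p; rewrite !inE // /shear eqxx; lia.
    apply/fintype.subsetP => l; rewrite !inE /shear.
    by case: eqP => [->|_]; rewrite ?addr0 //; lia.
have ij : i != j by apply: contraTneq cj => <-; lia.
(* From [c i = b] and [- b <= - a <= c j < 0], the sum [c i + c j] lies in the range that [step]
   requires. *)
have cji := cb j.
have [BYij|Yij|Yji] := above_cases (Y i - Y j).
- case: (unliftP i j) ij BYij => [j' ->|->]; last by rewrite eqxx.
  by move=> _ /liftable_congr; apply; apply: IHm.
- by apply: (step j i) => //; [rewrite eq_sym | lia | rewrite cj | lia].
- by apply: (step i j) => //; [lia | lia | lia | rewrite -opprB].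
Qed.

Lemma liftable_above m (Y : 'I_m -> A) :
  (forall k, above (Y k)) -> liftable Y.
Proof.
elim: m Y => [|m IHm] Y Y_above.
  move=> w _; exists (fun=> 0) => [[] //|c _].
  by rewrite /zcomb !big_ord0.
have [[c [BYc c_neq0]]|no_rel] :=
    pselect (exists c, B (zcomb Y c) /\ exists i, c i != 0).
  pose M := \max_i `|c i|%N.
  apply: (liftable_descent IHm (leqnn _) (leqnn M) Y_above BYc c_neq0 _
    (leqnn _)).
  by move=> i; have : (`|c i| <= M)%N := leq_bigmax i; lia.
(* Only the trivial relation has to be respected, so constant lifts suffice. *)
move=> w Bw; exists (fun=> w) => [//|c BYc].
have c0 i : c i = 0.
  by apply: contrapT => /eqP ci; apply: no_rel; exists c; split => //; exists i.
by rewrite /zcomb !big1 // => i _; rewrite c0 mulr0z.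
Qed.

(* [h] is a homomorphism on the subgroup generated by [B] and [X], extended by
   the junk value 0. *)
Lemma finite_retraction (X : seq A) : 'f_A != 0 -> exists h : A -> A,
  [/\ forall x, B (h x),
      forall x, B x -> h x = x,
      {in X &, {morph h : x y / x - y}} &
      {in X, forall x, 0 < x -> 0 < h x}].
Proof.
move=> f_neq0.
(* A strictly positive lower bound for the lifts, namely the absolute value of the nonzero point. *)
have [w Bw w_gt0] : exists2 w, B w & 0 < w.
  have Bf := subalg_point BP.
  have [f0|f0] := orP (A_total 0 'f_A).
    by exists 'f_A; rewrite // lt_def f_neq0.
  exists (- 'f_A); first exact: subalgN BP _ Bf.
  by rewrite lt_def oppr_eq0 f_neq0 lg_oppr_ge0.
(* With the negatives included, every element of [X] lies in [B] or is a generator up to sign. *)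
pose s := [seq x <- X ++ map -%R X | `[< above x >]].
pose Y := tnth (in_tuple s).
have Y_above k : above (Y k).
  by have := mem_tnth k (in_tuple s); rewrite mem_filter => /andP[/asboolP].
have Y_onto x : above x -> x \in X ++ map -%R X -> exists k, Y k = x.
  move=> x_above Xx; have /tnthP[k ->] : x \in in_tuple s.
    by rewrite mem_filter Xx andbT; apply/asboolP.
  by exists k.
have [z zP zE] := liftable_above Y_above Bw.
pose rep x (cu : ('I_(size s) -> int) * A) := B cu.2 /\ x = zcomb Y cu.1 + cu.2.
pose h x := if pselect (exists cu, rep x cu) is left e
            then zcomb z (projT1 (cid e)).1 + (projT1 (cid e)).2 else 0.
have B0 := subalg0 BP.
have Bz c : B (zcomb z c).
  apply: big_ind => [//|x y Bx By|k _]; first exact: subalgD.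
  by apply: subalgMz; have [] := zP k.
(* Two representations of one element differ by a relation modulo [B], which [z] respects, so the
   chosen one does not matter. *)
have hE c u : B u -> h (zcomb Y c + u) = zcomb z c + u.
  move=> Bu; rewrite /h; case: pselect => [e|[]]; last by exists (c, u).
  case: cid => -[c' u'] /= [/= Bu' E].
  have dE : zcomb Y (fun k => c' k - c k) = u - u'.
    rewrite zcombB; apply/eqP.
    by rewrite subr_eq addrAC eq_sym subr_eq -E addrC.
  have := zE (fun k => c' k - c k); rewrite dE => /(_ (subalgB Bu Bu')).
  rewrite zcombB => /eqP.
  by rewrite subr_eq addrAC eq_sym subr_eq addrC => /eqP ->.
have zcomb0 (V : zmodType) (u : 'I_(size s) -> V) : zcomb u (fun=> 0) = 0.
  by rewrite /zcomb big1 // => k _; rewrite mulr0z.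
have hB x : B x -> h x = x.
  by move=> Bx; have := hE (fun=> 0) x Bx; rewrite !zcomb0 !add0r.
have hY k : h (Y k) = z k.
  have := hE (fun l => if l == k then 1 else 0) 0 B0.
  by rewrite !zcomb_single !mulr1z !addr0.
have repX x : x \in X -> exists c u, B u /\ x = zcomb Y c + u.
  move=> Xx; have [Bx|x_above|x_below] := above_cases x.
  - by exists (fun=> 0), x; rewrite zcomb0 add0r.
  - have [|k <-] := Y_onto x x_above; first by rewrite mem_cat Xx.
    by exists (fun l => if l == k then 1 else 0), 0; rewrite zcomb_single addr0.
  have [|k Yk] := Y_onto (- x) x_below.
    by rewrite mem_cat (map_f -%R Xx) orbT.
  exists (fun l => if l == k then -1 else 0), 0.
  by rewrite zcomb_single addr0 mulrNz Yk opprK.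
exists h; split => //.
- move=> x; rewrite /h; case: pselect => // e.
  by case: cid => -[c u] [/= Bu _]; apply: subalgD.
- move=> x y /repX[c [u [Bu ->]]] /repX[d [v [Bv ->]]].
  have -> : zcomb Y c + u - (zcomb Y d + v) =
            zcomb Y (fun k => c k - d k) + (u - v).
    by rewrite zcombB opprD addrACA.
  by rewrite !hE //; [rewrite zcombB opprD addrACA | exact: subalgB].
move=> x Xx x_gt0; have [Bx|x_above|[]] := above_cases x.
- by rewrite hB.
- have [|k <-] := Y_onto x x_above; first by rewrite mem_cat Xx.
  by rewrite hY; apply: lt_le_trans w_gt0 _; have [] := zP k.
by move=> /ltW; rewrite lg_oppr_ge0 => /(lt_le_trans x_gt0); rewrite ltxx.
Qed.

End Lifting.

(** * Gluing approximate embeddings along a filter *)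

Section ApproximateEmbedding.
Context {A B : plgroupType} {J : Type} {G : set_system J} {GF : ProperFilter G}.
Variable h : J -> A -> B.
Hypotheses
  (h0 : \forall j \near G, h j 0 = 0)
  (hN : forall x, \forall j \near G, h j (- x) = - h j x)
  (hD : forall x y, \forall j \near G, h j (x + y) = h j x + h j y)
  (hI : forall x y, \forall j \near G, h j (x `&` y) = h j x `&` h j y)
  (hU : forall x y, \forall j \near G, h j (x `|` y) = h j x `|` h j y)
  (hf : \forall j \near G, h j 'f_A = 'f_B)
  (h_inj : forall x y, x <> y -> \forall j \near G, h j x <> h j y).

(** The class of [u] goes to the class of [(i, j) |-> h j (u i)], modulo an ultrafilter refining the
    iterated filter of [F] and [G]. *)
Lemma ultrapower_approx_embedding (I : Type) (F : set_system I)
    (FU : UltraFilter F) :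
  exists (K : Type) (H : set_system K) (HU : UltraFilter H)
    (g : ultrapower A FU -> ultrapower B HU), is_plghom g /\ injective g.
Proof.
(* With [i] quantified outside, the good [j] may depend on [i], so no uniformity over [A] is asked
   of [h]. *)
pose H0 : set_system (I * J) :=
  fun S => \forall i \near F, \forall j \near G, S (i, j).
have H0_proper : ProperFilter H0.
  split; first by move=> /(@filter_ex _ F)[i]; move=> /(@filter_ex _ G)[].
  split=> [|P Q HP HQ|P Q PQ HP]; rewrite /H0.
  - by apply: nearW => i; apply: nearW.
  - by apply: (filterS2 (F := F)) HP HQ => i; apply: filterS2.
  - by apply: (filterS (F := F)) HP => i; apply: filterS => j; apply: PQ.
have [H [HU H0H]] := ultraFilterLemma H0_proper.
have near_H (P : set (I * J)) : (forall i, \forall j \near G, P (i, j)) -> H P.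
  by move=> GP; apply: H0H; apply: nearW.
pose k u (p : I * J) := h p.2 (u p.1).
pose g (x : ultrapower A FU) : ultrapower B HU := up_class HU (k (repr x)).
have gE u : g (up_class FU u) = up_class HU (k u).
  apply/up_classP; apply: H0H; apply: filterS (up_class_repr FU u) => i ui.
  by apply: nearW => j; rewrite /k /= ui.
exists (I * J)%type, H, HU, g; split; last first.
  move=> x y; have [u ->] := up_class_surj x; have [v ->] := up_class_surj y.
  rewrite !gE => /up_classP kuv; apply/up_classP.
  (* As [F] is ultra, distinct classes differ at [F]-almost every [i], where [h_inj] applies. *)
  have [//|nuv] := in_ultra_setVsetC (fun i => u i = v i) FU.
  have : H (fun p => k u p <> k v p).
    by apply: H0H; apply: filterS nuv => i; apply: h_inj.
  by move=> kuv'; have [p []] := filter_ex (filterI kuv kuv').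
have surj := @up_class_surj A I F FU.
split=> [|x|x y|x y|x y|].
- by rewrite gE; apply/up_classP; apply: near_H.
- have [u ->] := surj x; rewrite /GRing.opp /= up_oppE !gE up_oppE.
  by apply/up_classP; apply: near_H => i; exact: (hN (u i)).
- have [u ->] := surj x; have [v ->] := surj y.
  rewrite /GRing.add /= up_addE !gE up_addE.
  by apply/up_classP; apply: near_H => i; exact: (hD (u i) (v i)).
- have [u ->] := surj x; have [v ->] := surj y.
  rewrite /lgmeet /= up_meetE !gE up_meetE.
  by apply/up_classP; apply: near_H => i; exact: (hI (u i) (v i)).
- have [u ->] := surj x; have [v ->] := surj y.
  rewrite /lgjoin /= up_joinE !gE up_joinE.
  by apply/up_classP; apply: near_H => i; exact: (hU (u i) (v i)).
by rewrite gE; apply/up_classP; apply: near_H.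
Qed.

End ApproximateEmbedding.

(** * Membership in the generated class as embeddability into an ultrapower *)

Lemma is_plghom_comp (A B C : plgroupType) (g : B -> C) (f : A -> B) :
  is_plghom g -> is_plghom f -> is_plghom (g \o f).
Proof.
move=> [g0 gN gD gI gU gf] [f0 fN fD fI fU ff].
split=> [|x|x y|x y|x y|] /=.
- by rewrite f0.
- by rewrite fN.
- by rewrite fD.
- by rewrite fI.
- by rewrite fU.
- by rewrite ff.
Qed.

(** [C] is isomorphic to the range of [h], a subalgebra of [A]. *)
Lemma class_IS_embedding (K : plg_class) (A C : plgroupType) (h : C -> A) :
  K A -> is_plghom h -> injective h -> class_I (class_S K) C.
Proof.
move=> KA [h0 hN hD hI hU hf] h_inj.
have range_subalg : is_subalgebra (range h).
  split.
  - by exists 0.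
  - by move=> _ [x _ <-]; exists (- x).
  - by move=> _ _ [x _ <-] [y _ <-]; exists (x + y).
  - by move=> _ _ [x _ <-] [y _ <-]; exists (x `&` y).
  - by move=> _ _ [x _ <-] [y _ <-]; exists (x `|` y).
  - by exists 'f_C.
pose S := Subalgebra range_subalg.
have hS x : h x \in subalg_set S by rewrite in_setE; exists x.
apply: (ClassI (A := S)); first exact: ClassS.
exists (fun x => exist _ (h x) (hS x) : S).
  by split=> [|x|x y|x y|x y|]; apply: val_inj => /=.
have inv (y : S) : exists x, h x = val y.
  by have := valP y; rewrite in_setE => -[x _ hx]; exists x.
exists (fun y => projT1 (cid (inv y))) => [x|y]; last first.
  by apply: val_inj; rewrite /= (projT2 (cid (inv y))).
by apply: h_inj; apply: (projT2 (cid (inv _))).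
Qed.

Lemma class_ISPU_singP (A C : plgroupType) : class_ISPU (class_sing A) C ->
  exists (I : Type) (F : set_system I) (FU : UltraFilter F)
    (h : C -> ultrapower A FU), is_plghom h /\ injective h.
Proof.
case=> A1 {}C SA1 [h h_hom /bij_inj h_inj].
case: SA1 h h_hom h_inj => A2 S PA2.
case: PA2 S => A3 I F FU [] S h h_hom h_inj.
exists I, F, FU, (val \o h); split; last exact: inj_comp val_inj h_inj.
by apply: is_plghom_comp h_hom.
Qed.

Lemma class_ISPU_approx_embedding (A B : plgroupType) (J : Type)
    (G : set_system J) (h : J -> A -> B) : ProperFilter G ->
    (\forall j \near G, h j 0 = 0) ->
    (forall x, \forall j \near G, h j (- x) = - h j x) ->
    (forall x y, \forall j \near G, h j (x + y) = h j x + h j y) ->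
    (forall x y, \forall j \near G, h j (x `&` y) = h j x `&` h j y) ->
    (forall x y, \forall j \near G, h j (x `|` y) = h j x `|` h j y) ->
    (\forall j \near G, h j 'f_A = 'f_B) ->
    (forall x y, x <> y -> \forall j \near G, h j x <> h j y) ->
  forall C, class_ISPU (class_sing A) C -> class_ISPU (class_sing B) C.
Proof.
move=> GF h0 hN hD hI hU hf h_inj C.
move=> /class_ISPU_singP[I [F [FU [u [u_hom u_inj]]]]].
have [K [H [HU [g [g_hom g_inj]]]]] :=
  ultrapower_approx_embedding h0 hN hD hI hU hf h_inj FU.
apply: (class_IS_embedding (h := g \o u)); last exact: inj_comp g_inj u_inj.
  exact: (ClassPU HU (ClassSing B)).
exact: is_plghom_comp.
Qed.

(** * The filter of finite subsets and the equality of the two classes *)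

Definition seq_filter (T : eqType) : set_system (seq T) :=
  fun S => exists s0 : seq T, forall s, {subset s0 <= s} -> S s.

Lemma seq_filter_proper (T : eqType) : ProperFilter (@seq_filter T).
Proof.
split; first by move=> [s0 /(_ s0)]; apply.
split=> [|P Q [s1 P1] [s2 Q2]|P Q PQ [s0 P0]].
- by exists [::].
- exists (s1 ++ s2) => s sub; split; [apply: P1|apply: Q2] => x xs; apply: sub.
    by rewrite mem_cat xs.
  by rewrite mem_cat xs orbT.
- by exists s0 => s /P0 /PQ.
Qed.

Lemma near_seq_filter (T : eqType) (s0 : seq T) :
  \forall s \near @seq_filter T, {subset s0 <= s}.
Proof. by exists s0. Qed.

Theorem theorem3p10 (A : plgroupType)
    (A_fg : finitely_generated A)
    (A_total : total (<=%R : rel A))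
    (b_neq0 : 'f_A != 0)
    (B : subalgebra A)
    (B_convex : order_convex B)
    (B_sp : strongly_pointed B) :
  forall C : plgroupType,
    class_ISPU (class_sing A) C <-> class_ISPU (class_sing B) C.
Proof.
move=> C; have BP := subalgP B; have SF := seq_filter_proper A.
split; last first.
  (* The inclusion of [B] in [A] serves as a constant family. *)
  apply: (class_ISPU_approx_embedding (h := fun (_ : seq A) (x : B) => val x)
    SF) => *; apply: nearW => _ //.
  by move=> /val_inj.
have [h hP] :=
  choice (fun s => finite_retraction BP A_total B_convex s b_neq0).
have hB s x : h s x \in subalg_set B.
  by rewrite in_setE; have [hs _ _ _] := hP s; apply: hs.
have h_id s x : subalg_set B x -> h s x = x by have [_ + _ _] := hP s; apply.
have h0 s : h s 0 = 0 by apply: h_id; apply: subalg0 BP.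
have h_sub (x y : A) (s : seq A) : {subset [:: x; y] <= s} ->
    h s (x - y) = h s x - h s y.
  have [_ _ hs _] := hP s.
  by move=> xys; apply: hs; apply: xys; rewrite !inE eqxx ?orbT.
have h_opp (x : A) (s : seq A) : {subset [:: 0; x] <= s} -> h s (- x) = - h s x.
  by move=> /h_sub; rewrite h0 !sub0r.
(* Positivity of [h s] is known only on [s], so [y - x] must belong to [s] too. *)
have h_lt (x y : A) (s : seq A) : {subset [:: y; x; y - x] <= s} ->
    x < y -> h s x < h s y.
  move=> xys xy; have [_ _ _ hs] := hP s.
  have : 0 < h s (y - x).
    apply: hs; first by apply: xys; rewrite !inE eqxx !orbT.
    by rewrite lt_def subr_eq0 lg_subr_ge0 -lt_def.
  rewrite h_sub => [|z zxy]; last first.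
    by apply: xys; rewrite -[_ :: _]/([:: y; x] ++ [:: y - x]) mem_cat zxy.
  by rewrite !lt_def subr_eq0 lg_subr_ge0.
pose hb s x : B := exist _ (h s x) (hB s x).
(* Totality reduces meets, joins and injectivity to eventual preservation of the strict order. *)
have total_cases (x y : A) : [\/ x = y, x < y | y < x].
  have [->|xy] := eqVneq x y; first by constructor 1.
  have [?|?] := orP (A_total x y); [constructor 2|constructor 3].
    by rewrite lt_def eq_sym xy.
  by rewrite lt_def xy.
have near_lt (x y : A) : x < y ->
    \forall s \near @seq_filter A, hb s x < hb s y.
  move=> xy; apply: filterS (near_seq_filter [:: y; x; y - x]) => s xys.
  exact: h_lt.
apply: (class_ISPU_approx_embedding (h := hb) SF).
- by apply: nearW => s; apply: val_inj; apply: h0.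
- move=> x; apply: filterS (near_seq_filter [:: 0; x]) => s xs.
  by apply: val_inj; apply: h_opp.
(* The sum is handled as [x - (- y)], since [h s] is known to respect differences. *)
- move=> x y; apply: filterS2 (near_seq_filter [:: x; - y])
    (near_seq_filter [:: 0; y]) => s /h_sub + /h_opp.
  by rewrite opprK => hxy hy; apply: val_inj; rewrite /= hxy hy opprK.
- move=> x y; have [<-|xy|yx] := total_cases x y.
  + by apply: nearW => s; rewrite !lgmeet_l.
  + by apply: filterS (near_lt _ _ xy) => s /ltW hxy; rewrite !lgmeet_l // ltW.
  + by apply: filterS (near_lt _ _ yx) => s /ltW hyx; rewrite !lgmeet_r // ltW.
- move=> x y; have [<-|xy|yx] := total_cases x y.
  + by apply: nearW => s; rewrite !lgjoin_l.
  + by apply: filterS (near_lt _ _ xy) => s /ltW hxy; rewrite !lgjoin_r // ltW.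
  + by apply: filterS (near_lt _ _ yx) => s /ltW hyx; rewrite !lgjoin_l // ltW.
- by apply: nearW => s; apply: val_inj; apply: h_id; apply: subalg_point BP.
move=> x y; have [//|xy _|yx _] := total_cases x y.
  by apply: filterS (near_lt _ _ xy) => s + E; rewrite E ltxx.
by apply: filterS (near_lt _ _ yx) => s + E; rewrite E ltxx.
Qed.
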